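(* Let $(A_{m,n})_{m,n\in\mathbb N}$ be an infinite complex matrix and suppose that for some $\gamma_0\ge 0$, $\gamma_1>0$, $C_0>0$, $C_1>0$, $$|A_{m,n}|\le \begin{cases} C_0\, n^{\gamma_0}, & n>m,\\ C_1\, n^{\gamma_1}m^{-\gamma_1}, & n\le m,\end{cases}\qquad m,n\in\mathbb N.$$ Then for every $\varepsilon\in(0,1)$, $\mathcal A$ is a continuous operator from $\mathbf s_{\gamma_1+\gamma_0+1+\varepsilon}$ into $\mathbf s_{\gamma_1}$.
   Context: $\mathbb N=\{1,2,\dots\}$. For a matrix $(A_{m,n})_{m,n\in\mathbb N}$, $\mathcal A$ denotes the linear map $(c_n)_{n=1}^\infty\mapsto (a_m)_{m=1}^\infty$ with $a_m=\sum_{n=1}^\infty A_{m,n}c_n$; saying that $\mathcal A$ is a continuous operator from one sequence space into another includes the assertion that these series converge for all sequences in the domain. For real $k\ge0$, $\mathbf s_k$ is the Banach space of complex sequences $(a_n)_{n=1}^\infty$ with finite norm $\sup_{n\in\mathbb N}|a_n|n^k$. *)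

(* Defs.v *)
(* Sequences and matrices indexed by {1, 2, ...} are functions on nat, with the
   index shifted by one: [a n] is the entry a_{n+1} of the mathematical
   sequence, [A m n] is A_{m+1,n+1}. *)
From Stdlib Require Import Reals Lra FunctionalExtensionality ProofIrrelevance.
From Coquelicot Require Import Coquelicot.
Open Scope R_scope.

(* (n+1)^k: the k-th real power of the one-based index stored at n. *)
Definition index_pow (n : nat) (k : R) : R := Rpower (INR (S n)) k.

Definition wnorm (k : R) (a : nat -> C) : Rbar :=
  Sup_seq (fun n => Finite (Cmod (a n) * index_pow n k)).

Record s_space (k : R) : Type := mk_s
  { s_seq :> nat -> C;
    s_finite : is_finite (wnorm k s_seq) }.

Arguments mk_s {k} _ _.
Arguments s_seq {k} _ _.
Arguments s_finite {k} _.

Definition s_norm (k : R) (a : s_space k) : R := real (wnorm k a).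

Lemma index_pow_pos n k : 0 < index_pow n k.
Proof. apply exp_pos. Qed.

Lemma wnorm_bounded k (a : nat -> C) (M : R) :
  (forall n, Cmod (a n) * index_pow n k <= M) ->
  is_finite (wnorm k a) /\ real (wnorm k a) <= M.
Proof.
intros H.
assert (Hle : Rbar_le (wnorm k a) M).
{ apply Rbar_not_lt_le; intros Hlt.
  apply Sup_seq_minor_lt in Hlt; destruct Hlt as [n Hn].
  simpl in Hn; specialize (H n); lra. }
assert (Hge : Rbar_le (Cmod (a O) * index_pow O k)%R (wnorm k a)).
{ apply (Sup_seq_minor_le _ _ O); apply Rle_refl. }
destruct (wnorm k a); simpl in *; try tauto.
split; [reflexivity | exact Hle].
Qed.

Lemma s_norm_ub k (a : s_space k) n :
  Cmod (a n) * index_pow n k <= s_norm k a.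
Proof.
assert (Hge : Rbar_le (Cmod (a n) * index_pow n k)%R (wnorm k a)).
{ apply (Sup_seq_minor_le _ _ n); apply Rle_refl. }
unfold s_norm; rewrite <- (s_finite a) in Hge; exact Hge.
Qed.

Lemma s_ext k (a b : s_space k) : (forall n, a n = b n) -> a = b.
Proof.
destruct a as [a Ha], b as [b Hb]; simpl; intros H.
assert (E : a = b) by (apply functional_extensionality; exact H).
subst b; f_equal; apply proof_irrelevance.
Qed.

Lemma s_plus_bound k (a b : s_space k) n :
  Cmod (a n + b n)%C * index_pow n k <= s_norm k a + s_norm k b.
Proof.
pose proof (s_norm_ub k a n); pose proof (s_norm_ub k b n).
pose proof (Cmod_triangle (a n) (b n)); pose proof (index_pow_pos n k).
nra.
Qed.

Lemma s_scal_bound k (l : C) (a : s_space k) n :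
  Cmod (l * a n)%C * index_pow n k <= Cmod l * s_norm k a.
Proof.
rewrite Cmod_mult, Rmult_assoc.
apply Rmult_le_compat_l; [apply Cmod_ge_0 | apply s_norm_ub].
Qed.

Lemma s_zero_bound k n : Cmod ((fun _ : nat => RtoC 0) n) * index_pow n k <= 0.
Proof. cbv beta; rewrite Cmod_0; lra. Qed.

Definition s_zero k : s_space k :=
  mk_s (fun _ => RtoC 0) (proj1 (wnorm_bounded k _ 0 (s_zero_bound k))).
Definition s_plus k (a b : s_space k) : s_space k :=
  mk_s (fun n => a n + b n)%C
    (proj1 (wnorm_bounded k _ _ (s_plus_bound k a b))).
Definition s_scal k (l : C) (a : s_space k) : s_space k :=
  mk_s (fun n => l * a n)%C
    (proj1 (wnorm_bounded k _ _ (s_scal_bound k l a))).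
Definition s_opp k (a : s_space k) : s_space k := s_scal k (RtoC (-1)) a.
Definition s_ball k (a : s_space k) (e : R) (b : s_space k) : Prop :=
  s_norm k (s_plus k b (s_opp k a)) < e.

Lemma s_plus_comm k a b : s_plus k a b = s_plus k b a.
Proof. apply s_ext; intros n; simpl; ring. Qed.
Lemma s_plus_assoc k a b c :
  s_plus k a (s_plus k b c) = s_plus k (s_plus k a b) c.
Proof. apply s_ext; intros n; simpl; ring. Qed.
Lemma s_plus_zero k a : s_plus k a (s_zero k) = a.
Proof. apply s_ext; intros n; simpl; ring. Qed.
Lemma s_plus_opp k a : s_plus k a (s_opp k a) = s_zero k.
Proof. apply s_ext; intros n; simpl; ring. Qed.
Lemma s_scal_assoc k (x y : C) a :
  s_scal k x (s_scal k y a) = s_scal k (x * y)%C a.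
Proof. apply s_ext; intros n; simpl; ring. Qed.
Lemma s_scal_one k a : s_scal k (RtoC 1) a = a.
Proof. apply s_ext; intros n; simpl; ring. Qed.
Lemma s_scal_plus_r k (x : C) a b :
  s_scal k x (s_plus k a b) = s_plus k (s_scal k x a) (s_scal k x b).
Proof. apply s_ext; intros n; simpl; ring. Qed.
Lemma s_scal_plus_l k (x y : C) a :
  s_scal k (x + y)%C a = s_plus k (s_scal k x a) (s_scal k y a).
Proof. apply s_ext; intros n; simpl; ring. Qed.

Lemma s_norm_triangle k a b :
  s_norm k (s_plus k a b) <= s_norm k a + s_norm k b.
Proof. exact (proj2 (wnorm_bounded k _ _ (s_plus_bound k a b))). Qed.
Lemma s_norm_scal k (l : C) a : s_norm k (s_scal k l a) <= Cmod l * s_norm k a.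
Proof. exact (proj2 (wnorm_bounded k _ _ (s_scal_bound k l a))). Qed.
Lemma s_norm_zero_le k : s_norm k (s_zero k) <= 0.
Proof. exact (proj2 (wnorm_bounded k _ _ (s_zero_bound k))). Qed.
Lemma s_norm_eq_0 k a : s_norm k a = 0 -> a = s_zero k.
Proof.
intros H; apply s_ext; intros n; simpl; apply Cmod_eq_0.
pose proof (s_norm_ub k a n); pose proof (index_pow_pos n k).
pose proof (Cmod_ge_0 (a n)); nra.
Qed.

Lemma s_ball_center k (a : s_space k) (e : posreal) : s_ball k a e a.
Proof.
unfold s_ball; rewrite s_plus_opp.
pose proof (s_norm_zero_le k); pose proof (cond_pos e); lra.
Qed.
Lemma s_ball_sym k (a b : s_space k) (e : R) : s_ball k a e b -> s_ball k b e a.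
Proof.
unfold s_ball; intros H.
replace (s_plus k a (s_opp k b)) with (s_opp k (s_plus k b (s_opp k a)))
  by (apply s_ext; intros n; simpl; ring).
pose proof (s_norm_scal k (RtoC (-1)) (s_plus k b (s_opp k a))) as H1.
rewrite Cmod_R, Rabs_left in H1 by lra; unfold s_opp at 1; lra.
Qed.
Lemma s_ball_triangle k (a b c : s_space k) (e1 e2 : R) :
  s_ball k a e1 b -> s_ball k b e2 c -> s_ball k a (e1 + e2) c.
Proof.
unfold s_ball; intros H1 H2.
replace (s_plus k c (s_opp k a))
  with (s_plus k (s_plus k c (s_opp k b)) (s_plus k b (s_opp k a)))
  by (apply s_ext; intros n; simpl; ring).
pose proof (s_norm_triangle k (s_plus k c (s_opp k b)) (s_plus k b (s_opp k a))).
lra.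
Qed.

Definition s_AbelianMonoid_mixin k :=
  AbelianMonoid.Mixin (s_space k) (s_plus k) (s_zero k)
    (s_plus_comm k) (s_plus_assoc k) (s_plus_zero k).
Canonical s_AbelianMonoid k :=
  AbelianMonoid.Pack (s_space k) (s_AbelianMonoid_mixin k) (s_space k).

Definition s_AbelianGroup_mixin k :=
  AbelianGroup.Mixin (s_AbelianMonoid k) (s_opp k) (s_plus_opp k).
Canonical s_AbelianGroup k :=
  AbelianGroup.Pack (s_space k)
    (AbelianGroup.Class (s_space k)
       (s_AbelianMonoid_mixin k) (s_AbelianGroup_mixin k)) (s_space k).

Definition s_ModuleSpace_mixin k :=
  ModuleSpace.Mixin C_Ring (s_AbelianGroup k) (s_scal k)
    (s_scal_assoc k) (s_scal_one k) (s_scal_plus_r k) (s_scal_plus_l k).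
Canonical s_ModuleSpace k :=
  ModuleSpace.Pack C_Ring (s_space k)
    (ModuleSpace.Class C_Ring (s_space k)
       (AbelianGroup.class (s_AbelianGroup k)) (s_ModuleSpace_mixin k))
    (s_space k).

Definition s_UniformSpace_mixin k :=
  UniformSpace.Mixin (s_space k) (s_zero k) (s_ball k)
    (s_ball_center k) (s_ball_sym k) (s_ball_triangle k).
Canonical s_UniformSpace k :=
  UniformSpace.Pack (s_space k) (s_UniformSpace_mixin k) (s_space k).

Canonical s_NormedModuleAux k :=
  NormedModuleAux.Pack C_AbsRing (s_space k)
    (NormedModuleAux.Class C_AbsRing (s_space k)
       (ModuleSpace.class C_Ring (s_ModuleSpace k))
       (UniformSpace.class (s_UniformSpace k)))
    (s_space k).

Lemma s_norm_ball k (a b : s_space k) (e : R) :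
  s_norm k (minus b a) < e -> ball a e b.
Proof. exact (fun H => H). Qed.
Lemma s_ball_norm k (a b : s_space k) (e : posreal) :
  ball a e b -> s_norm k (minus b a) < 1 * e.
Proof. rewrite Rmult_1_l; exact (fun H => H). Qed.

Definition s_NormedModule_mixin k :=
  NormedModule.Mixin C_AbsRing (s_NormedModuleAux k) (s_norm k) 1
    (s_norm_triangle k) (s_norm_scal k)
    (s_norm_ball k) (s_ball_norm k) (s_norm_eq_0 k).
Canonical s_NormedModule k : NormedModule C_AbsRing :=
  NormedModule.Pack C_AbsRing (s_space k)
    (NormedModule.Class C_AbsRing (s_space k)
       (NormedModuleAux.class C_AbsRing (s_NormedModuleAux k))
       (s_NormedModule_mixin k))
    (s_space k).

(* The series condition determines T uniquely; it asserts that every row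
   series converges for every c in s_k, and that the sums form a sequence
   in s_l. *)
Definition matrix_continuous_operator (A : nat -> nat -> C) (k l : R) : Prop :=
  exists T : s_space k -> s_space l,
    (forall (c : s_space k) (m : nat),
        is_series (V := C_NormedModule) (fun n => (A m n * c n)%C) (T c m)) /\
    (forall c d : s_space k, T (plus c d) = plus (T c) (T d)) /\
    (forall (z : C) (c : s_space k), T (scal z c) = scal z (T c)) /\
    (forall c : s_space k, continuous T c).

(* Main.v *)
(* For n > m the factor (n/m)^gamma1 is at least 1, so both cases of the
   hypothesis give |A_{m,n}| <= (C0 + C1) n^(gamma0+gamma1) m^(-gamma1).  Hence
   m^gamma1 |A_{m,n} c_n| <= (C0 + C1) n^(-1-eps) ||c||, and the right-hand side
   is summable in n, uniformly in m. *)
Require Import Defs.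
From Stdlib Require Import Reals Lra Lia IndefiniteDescription.
From Coquelicot Require Import Coquelicot.
Open Scope R_scope.

Lemma index_pow_plus n a b :
  index_pow n (a + b) = index_pow n a * index_pow n b.
Proof. apply Rpower_plus. Qed.

Lemma index_pow_opp_l n k : index_pow n (- k) * index_pow n k = 1.
Proof.
rewrite <- index_pow_plus, Rplus_opp_l.
apply Rpower_O, lt_0_INR; lia.
Qed.

Lemma index_pow_ge_1 n k : 0 <= k -> 1 <= index_pow n k.
Proof.
intros Hk.
rewrite <- (Rpower_O (INR (S n))) by (apply lt_0_INR; lia).
apply Rle_Rpower; [| exact Hk].
rewrite S_INR; pose proof (pos_INR n); lra.
Qed.

Lemma index_pow_le m n k : 0 <= k -> (m <= n)%nat -> index_pow m k <= index_pow n k.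
Proof.
intros Hk Hmn; apply Rle_Rpower_l; [exact Hk |].
split; [apply lt_0_INR; lia | apply le_INR; lia].
Qed.

(* Convexity of x^(-eps), obtained from 1 + t <= exp t and ln t <= t - 1. *)
Lemma index_pow_telescope n eps : 0 < eps ->
  eps * index_pow (S n) (-1 - eps) <= index_pow n (- eps) - index_pow (S n) (- eps).
Proof.
intros He.
set (x := INR (S n)).
assert (Hx : 0 < x) by (apply lt_0_INR; lia).
assert (HSx : INR (S (S n)) = x + 1) by (unfold x; rewrite (S_INR (S n)); ring).
assert (Hln : / (x + 1) <= ln (x + 1) - ln x).
{ assert (H : 1 + (ln x - ln (x + 1)) <= x / (x + 1)).
  { replace (x / (x + 1)) with (exp (ln x - ln (x + 1))).
    - apply exp_ineq1_le.
    - unfold Rminus; rewrite exp_plus, exp_Ropp, !exp_ln by lra; reflexivity. }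
  replace (x / (x + 1)) with (1 - / (x + 1)) in H by (field; lra).
  lra. }
assert (E1 : index_pow (S n) (-1 - eps) = / (x + 1) * index_pow (S n) (- eps)).
{ replace (-1 - eps) with (Ropp 1 + - eps) by ring.
  rewrite index_pow_plus; f_equal.
  unfold index_pow; rewrite HSx, Rpower_Ropp, Rpower_1 by lra; reflexivity. }
(* With t = eps (ln (x+1) - ln x), both sides now share the factor [index_pow (S n) (- eps)], and
   the claim reduces to eps / (x+1) <= t <= exp t - 1. *)
assert (E2 : index_pow n (- eps)
             = index_pow (S n) (- eps) * exp (eps * (ln (x + 1) - ln x))).
{ unfold index_pow, Rpower; rewrite HSx, <- exp_plus; fold x.
  f_equal; ring. }
rewrite E1, E2.
pose proof (index_pow_pos (S n) (- eps)) as Hp.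
pose proof (exp_ineq1_le (eps * (ln (x + 1) - ln x))) as Hexp.
assert (H : eps * / (x + 1) <= eps * (ln (x + 1) - ln x))
  by (apply Rmult_le_compat_l; lra).
nra.
Qed.

(** Summing the telescoping estimate bounds the increasing partial sums. In [Hb] the summand eps on
    the right pays for the term at index 0, which equals 1; the rest telescopes from 1 down to
    [index_pow N (- eps)]. *)
Lemma ex_series_index_pow eps : 0 < eps ->
  ex_series (fun n => index_pow n (-1 - eps)).
Proof.
intros He.
assert (Hb : forall N, eps * sum_n (fun n => index_pow n (-1 - eps)) N
                       <= eps + 1 - index_pow N (- eps)).
{ intros N; induction N as [| N IH].
  - rewrite sum_O; unfold index_pow, Rpower; simpl INR.
    rewrite ln_1, !Rmult_0_r, exp_0; lra.
  - rewrite sum_Sn; unfold plus; simpl.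
    pose proof (index_pow_telescope N eps He); lra. }
apply (ex_finite_lim_seq_incr _ ((eps + 1) / eps)).
- intros N; rewrite sum_Sn; unfold plus; simpl.
  pose proof (index_pow_pos (S N) (-1 - eps)); lra.
- intros N; apply Rle_div_r; [lra |].
  specialize (Hb N); pose proof (index_pow_pos N (- eps)).
  rewrite Rmult_comm; apply (Rle_trans _ _ _ Hb); lra.
Qed.

(** The triangle inequality for partial sums, passed to the limit. It will turn a termwise bound on
    a row into a bound on the row sum. *)
Lemma is_series_Cmod_le (a : nat -> C) (b : nat -> R) (s : C) :
  (forall n, Cmod (a n) <= b n) -> ex_series b ->
  is_series (V := C_NormedModule) a s -> Cmod s <= Series b.
Proof.
intros Hab Hb Hs.
apply (is_lim_seq_le (fun N => Cmod (sum_n a N)) (sum_n b) (Cmod s) (Series b)).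
- intros N; unfold sum_n.
  apply (Rle_trans _ (sum_n_m (fun n => Cmod (a n)) 0 N)).
  + exact (norm_sum_n_m (V := C_NormedModule) a 0 N).
  + apply sum_n_m_le; exact Hab.
- exact (filterlim_comp _ _ _ _ _ _ _ _ Hs (filterlim_norm (V := C_NormedModule) s)).
- exact (Series_correct b Hb).
Qed.

(** Used to deduce additivity and homogeneity of the operator from termwise identities between row
    series. *)
Lemma is_series_C_unique (a : nat -> C) (s t : C) :
  is_series (V := C_NormedModule) a s ->
  is_series (V := C_NormedModule) a t -> s = t.
Proof.
intros Hs Ht; exact (filterlim_locally_unique (V := C_NormedModule) _ s t Hs Ht).
Qed.

(** The two weights absorb the decay of c and produce the decay of the image: each term of row m is
    at most ||c|| [index_pow m (- l)] [b n]. Summing over n gives the operator bound ||T c|| <= (sum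
    of b) ||c||. *)
Lemma matrix_continuous_operator_dominated (A : nat -> nat -> C) (k l : R)
  (b : nat -> R) :
  ex_series b ->
  (forall m n, Cmod (A m n) <= b n * index_pow n k * index_pow m (- l)) ->
  matrix_continuous_operator A k l.
Proof.
intros Hb HA.
assert (Hterm : forall (c : s_space k) m n,
  Cmod (A m n * c n)%C <= s_norm k c * index_pow m (- l) * b n).
{ intros c m n; rewrite Cmod_mult.
  pose proof (s_norm_ub k c n) as Hc.
  pose proof (index_pow_pos n k); pose proof (index_pow_pos m (- l)).
  (* Nonnegativity of b is forced by [HA]: a positive multiple of [b n] dominates a modulus. *)
  assert (Hbn : 0 <= b n).
  { pose proof (Cmod_ge_0 (A m n)); specialize (HA m n).
    assert (0 < index_pow n k * index_pow m (- l)) by (apply Rmult_lt_0_compat; lra).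
    nra. }
  apply (Rle_trans _ (b n * index_pow n k * index_pow m (- l) * Cmod (c n))).
  - apply Rmult_le_compat_r; [apply Cmod_ge_0 | apply HA].
  - replace (b n * index_pow n k * index_pow m (- l) * Cmod (c n))
      with (index_pow m (- l) * b n * (Cmod (c n) * index_pow n k)) by ring.
    replace (s_norm k c * index_pow m (- l) * b n)
      with (index_pow m (- l) * b n * s_norm k c) by ring.
    apply Rmult_le_compat_l; [apply Rmult_le_pos; lra | exact Hc]. }
assert (Hsum : forall r, ex_series (fun n => r * b n))
  by (intros r; exact (ex_series_scal r b Hb)).
(* The norm bound is bundled with the row sums, so that choosing T yields its boundedness at the
   same time. *)
assert (HT : forall c : s_space k, exists Tc : s_space l,
  (forall m, is_series (V := C_NormedModule) (fun n => (A m n * c n)%C) (Tc m)) /\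
  s_norm l Tc <= Series b * s_norm k c).
{ intros c.
  destruct (functional_choice
    (fun m s => is_series (V := C_NormedModule) (fun n => (A m n * c n)%C) s))
    as [t Ht].
  (* Each row converges absolutely by comparison, hence converges since C is complete. *)
  { intros m; apply (ex_series_le (V := C_CompleteNormedModule) _
      (fun n => s_norm k c * index_pow m (- l) * b n)); [apply Hterm | apply Hsum]. }
  assert (Hbound : forall m, Cmod (t m) * index_pow m l <= Series b * s_norm k c).
  { intros m.
    pose proof (is_series_Cmod_le _ _ _ (Hterm c m) (Hsum _) (Ht m)) as H.
    rewrite Series_scal_l in H.
    replace (Series b * s_norm k c)
      with (s_norm k c * index_pow m (- l) * Series b * index_pow m l).
    - apply Rmult_le_compat_r; [apply Rlt_le, index_pow_pos | exact H].
    - replace (s_norm k c * index_pow m (- l) * Series b * index_pow m l)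
        with (s_norm k c * Series b * (index_pow m (- l) * index_pow m l)) by ring.
      rewrite index_pow_opp_l; ring. }
  destruct (wnorm_bounded l t _ Hbound) as [Hfin Hle].
  exists (mk_s t Hfin); split; [exact Ht | exact Hle]. }
destruct (functional_choice _ HT) as [T HTspec].
assert (Hplus : forall c d : s_space k, T (plus c d) = plus (T c) (T d)).
{ intros c d; apply s_ext; intros m.
  apply (is_series_C_unique _ _ _ (proj1 (HTspec (plus c d)) m)).
  refine (is_series_ext _ _ _ _ (is_series_plus (V := C_NormedModule) _ _ _ _
    (proj1 (HTspec c) m) (proj1 (HTspec d) m))).
  intros n; symmetry; exact (Cmult_plus_distr_l (A m n) (c n) (d n)). }
assert (Hscal : forall (z : C) (c : s_space k), T (scal z c) = scal z (T c)).
{ intros z c; apply s_ext; intros m.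
  apply (is_series_C_unique _ _ _ (proj1 (HTspec (scal z c)) m)).
  refine (is_series_ext _ _ _ _ (is_series_scal (V := C_NormedModule) z _ _
    (proj1 (HTspec c) m))).
  intros n; change (z * (A m n * c n) = A m n * (z * c n))%C; ring. }
exists T; split; [intros c m; apply HTspec |].
split; [exact Hplus |]; split; [exact Hscal |].
intros c; refine (linear_cont
  (U := s_NormedModule k) (V := s_NormedModule l) T c _).
split; [exact Hplus | exact Hscal |].
(* The operator bound must be strictly positive, whereas the sum of b may vanish. *)
exists (Rabs (Series b) + 1); split; [pose proof (Rabs_pos (Series b)); lra |].
intros d; apply (Rle_trans _ _ _ (proj2 (HTspec d))).
apply Rmult_le_compat_r.
- exact (norm_ge_0 (V := s_NormedModule k) d).
- pose proof (Rle_abs (Series b)); lra.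
Qed.

Theorem proposition3p2 (A : nat -> nat -> C) (gamma0 gamma1 C0 C1 : R)
  (Hgamma0 : 0 <= gamma0) (Hgamma1 : 0 < gamma1) (HC0 : 0 < C0) (HC1 : 0 < C1)
  (Hupper : forall m n : nat, (n > m)%nat ->
     Cmod (A m n) <= C0 * index_pow n gamma0)
  (Hlower : forall m n : nat, (n <= m)%nat ->
     Cmod (A m n) <= C1 * index_pow n gamma1 * index_pow m (- gamma1)) :
  forall eps : R, 0 < eps < 1 ->
    matrix_continuous_operator A (gamma1 + gamma0 + 1 + eps) gamma1.
Proof.
intros eps [Heps _].
apply (matrix_continuous_operator_dominated A _ _
  (fun n => (C0 + C1) * index_pow n (-1 - eps))).
{ exact (ex_series_scal (C0 + C1) _ (ex_series_index_pow eps Heps)). }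
intros m n.
rewrite (Rmult_assoc (C0 + C1)), <- index_pow_plus.
(* The 1 + eps in the domain exponent is exactly what the summable factor consumes. *)
replace (-1 - eps + (gamma1 + gamma0 + 1 + eps)) with (gamma0 + gamma1) by ring.
rewrite index_pow_plus.
pose proof (index_pow_pos n gamma1) as P1.
pose proof (index_pow_pos m (- gamma1)) as Pm.
pose proof (index_pow_ge_1 n gamma0 Hgamma0) as G0.
set (p := index_pow n gamma0) in *.
assert (Hq : 0 < index_pow n gamma1 * index_pow m (- gamma1))
  by (apply Rmult_lt_0_compat; assumption).
destruct (Nat.le_gt_cases n m) as [Hnm | Hnm].
(* On and below the diagonal only p >= 1 is needed: C1 q <= (C0 + C1) p q. *)
- apply (Rle_trans _ _ _ (Hlower m n Hnm)).
  set (q := index_pow n gamma1 * index_pow m (- gamma1)) in *.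
  replace ((C0 + C1) * (p * index_pow n gamma1) * index_pow m (- gamma1))
    with ((C0 + C1) * p * q) by (unfold q; ring).
  replace (C1 * index_pow n gamma1 * index_pow m (- gamma1))
    with (C1 * q) by (unfold q; ring).
  apply Rmult_le_compat_r; [lra | nra].
- apply (Rle_trans _ _ _ (Hupper m n Hnm)); fold p.
  (* Above the diagonal the missing factor q is inserted, at no cost because q >= 1. *)
  assert (Hq1 : 1 <= index_pow n gamma1 * index_pow m (- gamma1)).
  { rewrite <- (index_pow_opp_l m gamma1), Rmult_comm.
    apply Rmult_le_compat_r; [lra | apply index_pow_le; [lra | lia]]. }
  set (q := index_pow n gamma1 * index_pow m (- gamma1)) in *.
  replace ((C0 + C1) * (p * index_pow n gamma1) * index_pow m (- gamma1))
    with ((C0 + C1) * p * q) by (unfold q; ring).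
  assert (0 < C0 * p) by (apply Rmult_lt_0_compat; lra).
  assert (0 < C1 * p) by (apply Rmult_lt_0_compat; lra).
  nra.
Qed.
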